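(* Let $d>0$ be real and let $n \geq 1$ be an integer. Let $E \subset \mathbb{R}^n$ be compact and upper Ahlfors $d$-regular with $\mathcal{H}^d(E)>0$. If the second-order density $\sigma_d(\mathcal{H}^d|_E,x)$ exists and is constant for $\mathcal{H}^d$-almost every $x\in E$, with constant value denoted $\sigma_{d}(E)$, then $$\liminf_{p\nearrow d} \frac{\operatorname{Cap}_p(E)^p}{d-p} \ge \frac{\mathcal{H}^d(E)}{d \, \sigma_{d}(E)}.$$
   Context: Riesz energy and capacity: for a nonempty compact set $E\subset\mathbb{R}^n$ and $p>0$, the Riesz $p$-energy is $V_p(E) = \min_\mu \int_E \int_E |x-y|^{-p} \, d\mu(x)\, d\mu(y) \in (0,+\infty]$, where the minimum is over all (Borel) probability measures $\mu$ on $E$ (the minimum is attained, possibly with value $+\infty$). The Riesz $p$-capacity is $\operatorname{Cap}_p(E) = V_p(E)^{-1/p}$, which equals $0$ when $V_p(E)=+\infty$. $\mathcal{H}^d$ is $d$-dimensional Hausdorff measure (when $d$ is an integer, normalized to agree with Lebesgue measure on subsets of $\mathbb{R}^d$; the inequality is unaffected by the choice of normalization), and $\mathcal{H}^d|_E(\cdot)=\mathcal{H}^d(\cdot\cap E)$. $\mathbb{B}^n(x,r)$ is the open ball in $\mathbb{R}^n$ with center $x$ and radius $r$. Upper Ahlfors $d$-regular: a set $A \subset \mathbb{R}^n$ is upper Ahlfors $d$-regular if there is a constant $C>0$ such that $\mathcal{H}^d(\mathbb{B}^n(x,r)\cap A) \leq C r^d$ for all $x \in A$ and $r \in (0,\operatorname{diam}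 A]$. Second-order density at dimension $d$ of a finite Borel measure $\mu$ on $\mathbb{R}^n$: $\sigma_{d}(\mu, x) = \lim_{p\nearrow d} (d-p) \int_0^1 \mu(\mathbb{B}^n(x,r)) r^{-p-1} \, dr$ for $x\in\mathbb{R}^n$, provided the limit exists and is finite. If $\sigma_d(E)$ were $0$, the right side of the inequality is read as $+\infty$. *)

(* Defs.v *)
From HB Require Import structures.
From mathcomp Require Import all_boot all_order all_algebra.
From mathcomp Require Import all_classical all_reals all_analysis.
Set Implicit Arguments.
Unset Strict Implicit.
Unset Printing Implicit Defensive.
Import Order.TTheory GRing.Theory Num.Theory.
Import numFieldNormedType.Exports.
Local Open Scope classical_set_scope.
Local Open Scope ring_scope.

(* The library norm (and hence its [ball]) on ['rV[R]_n] is the sup norm; the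
   Euclidean distance is introduced separately. Both induce the topology of
   the library, so [open] and [compact] are used as they stand. *)
Definition euclidean_dist (R : realType) (n : nat) (x y : 'rV[R]_n) : R :=
  Num.sqrt (\sum_(i < n) (x ord0 i - y ord0 i) ^+ 2).

Definition euclidean_ball (R : realType) (n : nat) (x : 'rV[R]_n) (r : R)
    : set 'rV[R]_n :=
  [set y | euclidean_dist x y < r].

(* The maximum with 0 only matters for the empty set, since
   [ereal_sup set0 = -oo]. *)
Definition diam (R : realType) (n : nat) (A : set 'rV[R]_n) : \bar R :=
  maxe 0%E (ereal_sup [set (euclidean_dist x y)%:E | x in A & y in A]).

Definition Gamma (R : realType) (a : R) : R :=
  \int[lebesgue_measure]_(t in `]0, +oo[) (t `^ (a - 1) * expR (- t)).

(* For an integer d, the volume of the Euclidean unit ball of R^d. *)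
Definition unit_ball_volume (R : realType) (d : R) : R :=
  pi `^ (d / 2) / Gamma (d / 2 + 1).

Section hausdorff_measure.
Context {R : realType} {n : nat}.
Local Open Scope ereal_scope.

Definition hausdorff_premeasure (d delta : R) (A : set 'rV[R]_n) : \bar R :=
  ereal_inf [set \sum_(0 <= k <oo)
                   (unit_ball_volume d)%:E * (diam (U k) / 2%:E) `^ d
            | U in [set U : nat -> set 'rV[R]_n |
                     A `<=` \bigcup_k U k /\ forall k, diam (U k) <= delta%:E]].

(* The factor [unit_ball_volume d / 2 ^ d] is the normalization for which
   d-dimensional Hausdorff measure on R^d is Lebesgue measure. *)
Definition hausdorff_measure (d : R) (A : set 'rV[R]_n) : \bar R :=
  ereal_sup [set hausdorff_premeasure d delta A
            | delta in [set delta : R | (0 < delta)%R]].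

Definition hausdorff_restr (d : R) (E : set 'rV[R]_n)
    : set 'rV[R]_n -> \bar R :=
  fun A => hausdorff_measure d (A `&` E).

Definition upper_ahlfors_regular (d : R) (A : set 'rV[R]_n) : Prop :=
  exists2 C : R, (0 < C)%R &
    forall (x : 'rV[R]_n) (r : R), A x -> (0 < r)%R -> r%:E <= diam A ->
      hausdorff_measure d (euclidean_ball x r `&` A) <= (C * r `^ d)%:E.

(* "The second-order density of mu at x exists, is finite and equals s". *)
Definition has_second_order_density (d : R) (mu : set 'rV[R]_n -> \bar R)
    (x : 'rV[R]_n) (s : R) : Prop :=
  (d - p)%:E * \int[lebesgue_measure]_(r in `]0%R, 1%R[)
      (mu (euclidean_ball x r) * (r `^ (- p - 1))%:E)
    @[p --> d^'-] --> s%:E.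

End hausdorff_measure.

(* ['rV[R]_n] with its Borel sigma-algebra. *)
Definition borel_space (R : realType) (n : nat) :=
  g_sigma_algebraType (@open 'rV[R]_n).

Section riesz_capacity.
Context {R : realType} {n : nat}.
Local Open Scope ereal_scope.

(* [|x - y|^(-p)], written as [(1/|x - y|)^p]: the extended inverse of 0 is
   +oo, so that the kernel is +oo on the diagonal, whereas
   [powR 0 (- p)] would be 0. *)
Definition riesz_kernel (p : R) (x y : 'rV[R]_n) : \bar R :=
  ((euclidean_dist x y)%:E ^-1) `^ p.

(* The minimum in the definition of the energy is attained, hence it is the
   infimum. Probability measures on E are the Borel probability measures on
   the whole space that give E full mass. *)
Definition riesz_energy (p : R) (E : set 'rV[R]_n) : \bar R :=
  ereal_inf [set \int[mu]_(x in E) \int[mu]_(y in E) riesz_kernel p x y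
            | mu in [set mu : probability (borel_space R n) R | mu E = 1]].

(* [V^(-1/p)], written as [(1/V)^(1/p)], which is 0 for V = +oo. *)
Definition riesz_capacity (p : R) (E : set 'rV[R]_n) : \bar R :=
  ((riesz_energy p E)^-1) `^ (p^-1)%R.

End riesz_capacity.

(* Main.v *)
Require Import Defs.
From HB Require Import structures.
From mathcomp Require Import all_boot all_order all_algebra.
From mathcomp Require Import all_classical all_reals all_analysis.
From mathcomp Require Import measurable_realfun ring lra.
Import Order.TTheory GRing.Theory Num.Theory.
Import numFieldNormedType.Exports.
Local Open Scope classical_set_scope.
Local Open Scope ring_scope.
Local Open Scope ereal_scope.

(* Let nu be H^d restricted to E, of total mass M. Writing
   t^(-p) - 1 = int_t^1 p r^(-p-1) dr for the kernel and exchanging integrals,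
   the nu-potential of exponent p at x is at most
   p * int_0^1 nu(B(x,r)) r^(-p-1) dr + M. Times d - p, the inner integral tends
   to sigma for nu-almost every x and is bounded on E by Ahlfors regularity, so
   dominated convergence gives limsup (d - p) V_p(E) <= d sigma M / M^2 for the
   test measure nu / M; and Cap_p(E)^p = 1 / V_p(E). *)

Set Implicit Arguments.
Unset Strict Implicit.
Unset Printing Implicit Defensive.

(** * Metric outer measures *)

(** A lower bound on capacity is an upper bound on energy, so a single test measure suffices and the
    kernel need only be bounded from above. Distances of at least 1 cost no more than the additive
    mass term, which the factor [d - p] sends to 0; this is why only radii below 1 matter. Two
    obstacles shape the rest. The energy ranges over Borel measures, while [hausdorff_restr d E] is
    a set function on all sets: its additivity on Borel sets comes from Caratheodory's criterion for
    metric outer measures, used here with a finite total mass that compactness and regularity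
    provide. And the set where the density differs from [sigma] need not be Borel: the limit in [p]
    is tested along sequences, each of which has a Borel set of bad points inside an H^d-null
    set. *)

Definition separated_additive (R : realType) (T : pseudoMetricType R)
    (mu : set T -> \bar R) := forall (A B : set T) (e : R), (0 < e)%R ->
  (forall x y, A x -> B y -> ~ ball x e y) -> mu A + mu B <= mu (A `|` B).

(** Points of [X] deep inside [U] are separated from the part of [X] outside [U], so additivity
    holds for them; the shells left near the boundary of [U] have summable masses, so exhausting [U]
    from inside loses nothing. Finite mass lets the estimates be made in the reals. *)
Lemma open_caratheodory (R : realType) (T : pseudoMetricType R)
    (mu : {outer_measure set T -> \bar R}) (U : set T) :
  separated_additive mu -> mu setT < +oo -> open U ->
  mu.-caratheodory U.
Proof.
move=> mu_sep mufin oU; apply: le_caratheodory_measurable => X.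
have fin A : mu A \is a fin_num.
  rewrite ge0_fin_numE ?outer_measure_ge0//.
  by rewrite (le_lt_trans _ mufin)// le_outer_measure.
(* Inclusion of a ball in [U] stands in for a lower bound on the distance to the complement; [A k]
   is the part of [X] at depth [1 / (k + 1)] in [U]. *)
pose A k := X `&` [set x | ball x (k.+1%:R^-1)%R `<=` U].
pose B k := X `&` ~` [set x | ball x (k.+1%:R^-1)%R `<=` U].
have Amono k l : (k <= l)%N -> A k `<=` A l.
  move=> kl x [Xx xU]; split => // y /= xy; apply: xU; apply: le_ball xy.
  by rewrite lef_pV2 ?posrE ?ltr0Sn// ler_nat.
(* By the triangle inequality, a point within [gap k] of [A k] still has depth [1 / (k + 2)], hence
   is not in [B k.+1]. *)
pose gap k : R := (k.+1%:R^-1 - k.+2%:R^-1)%R.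
have gap0 k : (0 < gap k)%R.
  by rewrite subr_gt0 ltf_pV2 ?posrE ?ltr0Sn// ltr_nat.
have AB k x y : A k x -> B k.+1 y -> ~ ball x (gap k) y.
  move=> [_ xU] [_ yU] xy; apply: yU => z yz; apply: xU.
  by have := ball_triangle xy yz; rewrite /gap subrK.
pose C k := A k.+1 `&` B k.
pose a k := fine (mu (A k)); pose c k := fine (mu (C k)).
have le_mu V W : V `<=` W -> (fine (mu V) <= fine (mu W))%R.
  by move=> VW; apply: fine_le => //; exact: le_outer_measure.
have amono k l : (k <= l)%N -> (a k <= a l)%R by move=> /Amono/le_mu.
have sep V W e : (0 < e)%R -> (forall x y, V x -> W y -> ~ ball x e y) ->
    (fine (mu V) + fine (mu W) <= fine (mu (V `|` W)))%R.
  by move=> e0 h; rewrite -lee_fin EFinD !fineK//; exact: mu_sep h.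
(* A k and C k.+1 are separated and both lie in A k.+2; summing makes the
   increments c telescope, so that mu X < +oo controls their tails. *)
have ac k : (a k + c k.+1 <= a k.+2)%R.
  apply: (le_trans (sep _ _ _ (gap0 k) _)).
    by move=> x y Ax [_ By]; exact: AB By.
  apply: le_mu => x [|[]//]; exact: Amono (leq_trans (leqnSn _) (leqnSn _)) _.
have telescope m N :
    (\sum_(i < N) c (m.+1 + i)%N <= a (m + N)%N + a (m + N).+1 - a m - a m.+1)%R.
  elim: N => [|N IH]; first by rewrite big_ord0 addn0; lra.
  by rewrite big_ord_recr /= addnS addSn; have := ac (m + N)%N; lra.
have aX k : (a k + fine (mu (X `&` ~` U)) <= fine (mu X))%R.
  have k0 : (0 < k.+1%:R^-1 :> R)%R by rewrite invr_gt0.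
  apply: (le_trans (sep _ _ _ k0 _)).
    by move=> x y [_ xU] [_ yU] xy; apply/yU/xU.
  by apply: le_mu => x [] [].
pose S : set R := range a.
have supS : has_sup S.
  split; first by exists (a 0%N), 0%N.
  exists (fine (mu X)) => _ [k _ <-]; apply: le_trans (aX k).
  by rewrite lerDl fine_ge0// outer_measure_ge0.
have aS k : (a k <= sup S)%R by apply: ub_le_sup => //; [case: supS|exists k].
(* Cover by [A m.+1] and the shells beyond it: the former costs at most [sup S], the shells at most
   [2 * sup S - 2 * a m] by telescoping. The bound tends to [sup S] as [a m] does. *)
have muXU m : (fine (mu (X `&` U)) <= 3 * sup S - 2 * a m)%R.
  have XU : X `&` U `<=` A m.+1 `|` \bigcup_i C (m.+1 + i)%N.
    move=> x [Xx Ux].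
    have [k Ak] : exists k, A k x.
      have /nbhs_ballP[e /= e0 xU] := open_nbhs_nbhs (conj oU Ux).
      exists (Num.truncn e^-1); split => // y xy; apply: xU; apply: le_ball xy.
      rewrite invf_ple ?posrE//; exact/ltW/truncnS_gt.
    (* With [j] the least index such that [x] is in [A j], the point lies in the shell [C j.-1]
       unless [j] is small enough for [A m.+1]. *)
    have := ex_minnP (ex_intro (fun k => `[< A k x >]) k (asboolT Ak)).
    case=> j /asboolP Aj jmin.
    have [jm|mj] := leqP j m.+1; first by left; exact: Amono jm _ Aj.
    right; case: j Aj jmin mj => // j Aj jmin mj.
    exists (j - m.+1)%N => //; rewrite subnKC//.
    split => //; split => // xU.
    by have := jmin j (asboolT (conj Xx xU)); rewrite ltnn.
  rewrite -lee_fin fineK//.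
  apply: (le_trans (le_outer_measure mu _ _ XU)).
  apply: (le_trans (outer_measureU2 _ _ _)).
  have -> : (3 * sup S - 2 * a m = sup S + (2 * sup S - 2 * a m))%R by lra.
  rewrite EFinD; apply: leeD; first by rewrite -[mu _]fineK// lee_fin; exact: aS.
  apply: (le_trans (outer_measure_sigma_subadditive mu _)).
  apply: lime_le; first by apply: is_cvg_nneseries => *; exact: outer_measure_ge0.
  apply: nearW => N; rewrite big_mkord.
  under eq_bigr do rewrite -[mu _]fineK//.
  rewrite sumEFin lee_fin; apply: (le_trans (telescope m N)).
  have := (aS (m + N)%N, aS (m + N).+1, amono m m.+1 (leqnSn _)).
  by move=> [[? ?] ?]; lra.
have XS : (fine (mu (X `&` U)) <= sup S)%R.
  apply/ler_addgt0Pr => e e0.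
  have e2 : (0 < e / 2)%R by rewrite divr_gt0.
  have [_ [m _ <-] am] := sup_adherent e2 supS.
  by have := muXU m; lra.
have SX : (sup S + fine (mu (X `&` ~` U)) <= fine (mu X))%R.
  rewrite -lerBrDr; apply: ge_sup; first by case: supS.
  by move=> _ [k _ <-]; rewrite lerBrDr.
rewrite -(fineK (fin (X `&` U))) -(fineK (fin X)) -(fineK (fin (X `&` ~` U))).
by rewrite -EFinD lee_fin (le_trans _ SX)// lerD2r.
Qed.

(** The Caratheodory sets form a sigma-algebra containing the open sets, hence all Borel sets. The
    equality with [mu] is on all sets, so values at non-Borel sets stay available. *)
Lemma separated_borel_measure (R : realType) (T : pseudoPMetricType R)
    (mu : {outer_measure set T -> \bar R}) :
  separated_additive mu -> mu setT < +oo ->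
  exists nu : {finite_measure set (g_sigma_algebraType (@open T)) -> \bar R},
    (nu : set T -> \bar R) = mu.
Proof.
move=> mu_sep mufin.
have sub A : <<s @open T >> A -> mu.-caratheodory A.
  apply: smallest_sub => //; first split.
  - exact: caratheodory_measurable_set0.
  - by move=> B mB; rewrite setTD; exact: caratheodory_measurable_setC.
  - by move=> F mF; exact: caratheodory_measurable_bigcup.
  - by move=> U oU; exact: open_caratheodory.
have sigma_add :
    semi_sigma_additive (mu : set (g_sigma_algebraType (@open T)) -> \bar R).
  move=> F mF tF mbigF.
  apply: (@caratheodory_measure_sigma_additive R T mu) => //.
  - by move=> i; exact: sub (mF i).
  - exact: sub mbigF.
pose X := g_sigma_algebraType (@open T).
pose nu_measure := isMeasure.Build _ X R mu (outer_measure0 mu)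
  (outer_measure_ge0 mu) sigma_add.
have [nu nuE] : exists nu : {measure set X -> \bar R}, (nu : set T -> \bar R) = mu.
  by exists (HB.pack_for (Measure.type X R) (mu : set X -> \bar R) nu_measure).
have nu_fin : fin_num_fun nu by apply: lty_fin_num_fun; rewrite nuE.
have nu_sigma : sigma_finite setT nu.
  by apply: fin_num_fun_sigma_finite; rewrite ?measure0.
have nu_s : sfinite_measure nu by exact: sfinite_measure_sigma_finite.
exists (HB.pack_for (FiniteMeasure.type X R) (Measure.sort nu)
  (isFinite.Build _ _ _ _ nu_fin) (isSFinite.Build _ _ _ _ nu_s)
  (isSigmaFinite.Build _ _ _ _ nu_sigma)).
exact: nuE.
Qed.

(** * Hausdorff measure *)

Section euclidean.
Context {R : realType} {n : nat}.
Implicit Types (x y : 'rV[R]_n) (A : set 'rV[R]_n).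

Lemma euclidean_dist_ge0 x y : (0 <= euclidean_dist x y)%R.
Proof. exact: sqrtr_ge0. Qed.

(** The sup norm is at most the Euclidean norm, so sets separated for the library metric are
    separated for the distance that defines the Hausdorff measure. *)
Lemma ball_euclidean x y (e : R) : (euclidean_dist x y < e)%R -> ball x e y.
Proof.
move=> xye; have e0 := le_lt_trans (euclidean_dist_ge0 x y) xye.
split=> // i j; rewrite (ord1 i); apply: le_lt_trans xye.
rewrite /euclidean_dist -sqrtr_sqr ler_wsqrtr// (bigD1 j)//= lerDl.
by apply: sumr_ge0 => k _; exact: sqr_ge0.
Qed.

Lemma diam_ge0 A : 0 <= diam A.
Proof. by rewrite /diam le_max lexx. Qed.

Lemma diam_set0 : diam (set0 : set 'rV[R]_n) = 0.
Proof.
rewrite /diam [X in ereal_sup X](_ : _ = set0) ?ereal_sup0 ?maxeNy//.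
by apply/seteqP; split => // z [x []].
Qed.

Lemma dist_le_diam A x y : A x -> A y -> (euclidean_dist x y)%:E <= diam A.
Proof.
move=> Ax Ay; rewrite /diam le_max; apply/orP; right.
by apply: ereal_sup_ubound; exists x => //; exists y.
Qed.

End euclidean.

Lemma unit_ball_volume_ge0 (R : realType) (d : R) : (0 <= unit_ball_volume d)%R.
Proof.
rewrite divr_ge0 ?powR_ge0//; apply: Rintegral_ge0 => //= t _.
by rewrite mulr_ge0 ?powR_ge0 ?expR_ge0.
Qed.

Section hausdorff.
Context {R : realType} {n : nat} (d : R).
Hypothesis d_gt0 : (0 < d)%R.
Implicit Types (A B : set 'rV[R]_n).
Local Notation H := (hausdorff_measure d).
Local Notation Hpre := (hausdorff_premeasure d).

(** The value +oo on large sets encodes the restriction on the diameters of a cover, so that the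
    premeasure becomes the outer measure generated by one set function. *)
Definition gauge (delta : R) A : \bar R :=
  if diam A <= delta%:E
  then (unit_ball_volume d)%:E * (diam A / 2%:E) `^ d else +oo.

Lemma gauge_ge0 delta A : 0 <= gauge delta A.
Proof.
rewrite /gauge; case: ifPn => // _.
by rewrite mule_ge0 ?poweR_ge0// lee_fin unit_ball_volume_ge0.
Qed.

Lemma gauge0 delta : (0 < delta)%R -> gauge delta set0 = 0.
Proof.
move=> delta0; rewrite /gauge diam_set0 lee_fin (ltW delta0).
by rewrite mul0e poweR0r ?mule0// gt_eqF.
Qed.

(* Every set is measurable in the source, so that the covers of [mu_ext] are
   arbitrary. *)
Lemma hausdorff_premeasureE delta A : Hpre delta A =
  mu_ext (gauge delta : set (g_sigma_algebraType [set: set 'rV[R]_n]) -> _) A.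
Proof.
apply/eqP; rewrite eq_le; apply/andP; split.
  apply: le_ereal_inf_tmp => _ [U [_ AU] <-].
  have [Udelta|] := pselect (forall k, diam (U k) <= delta%:E).
    apply: ereal_inf_lbound; exists U => //.
    by apply: eq_eseriesr => k _; rewrite /gauge Udelta.
  move/existsNP => [k Uk]; rewrite [leRHS](@eseries_pinfty _ _ _ k) ?leey//.
    by move=> i _; rewrite -ltNye (lt_le_trans _ (gauge_ge0 _ _)).
  by rewrite /gauge; case: ifPn.
apply: le_ereal_inf_tmp => _ [U [AU Udelta] <-].
apply: ereal_inf_lbound; exists U.
  by split=> // k; exact: sub_sigma_algebra.
by apply: eq_eseriesr => k _; rewrite /gauge Udelta.
Qed.

Lemma hausdorff_premeasure_ge0 delta A : 0 <= Hpre delta A.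
Proof. by rewrite hausdorff_premeasureE mu_ext_ge0//; exact: gauge_ge0. Qed.

Lemma hausdorff_premeasure_le delta A : (0 < delta)%R -> Hpre delta A <= H A.
Proof. by move=> delta0; apply: ereal_sup_ubound; exists delta. Qed.

Lemma le_hausdorff_premeasure delta A B : A `<=` B -> Hpre delta A <= Hpre delta B.
Proof. by move=> AB; rewrite !hausdorff_premeasureE le_mu_ext. Qed.

Lemma hausdorff_premeasure_anti (e delta : R) A : (e <= delta)%R ->
  Hpre delta A <= Hpre e A.
Proof.
move=> edelta; apply: ereal_inf_le_tmp => _ [U [AU Ue] <-]; exists U => //.
by split=> // k; rewrite (le_trans (Ue k))// lee_fin.
Qed.

Lemma hausdorff_measure_ge0 A : 0 <= H A.
Proof.
exact: le_trans (hausdorff_premeasure_ge0 1 A) (hausdorff_premeasure_le _ ltr01).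
Qed.

Lemma hausdorff_measure0 : H (set0 : set 'rV[R]_n) = 0.
Proof.
apply/eqP; rewrite eq_le hausdorff_measure_ge0 andbT.
apply: ge_ereal_sup => _ [delta delta0 <-].
by rewrite hausdorff_premeasureE mu_ext0 ?gauge0//; exact: gauge_ge0.
Qed.

Lemma le_hausdorff_measure A B : A `<=` B -> H A <= H B.
Proof.
move=> AB; apply: ge_ereal_sup => _ [delta delta0 <-].
exact: le_trans (le_hausdorff_premeasure _ AB) (hausdorff_premeasure_le _ delta0).
Qed.

Lemma hausdorff_measure_sigma_subadditive : sigma_subadditive (H : set 'rV[R]_n -> _).
Proof.
move=> F; apply: ge_ereal_sup => _ [delta delta0 <-].
rewrite hausdorff_premeasureE.
apply: (le_trans (mu_ext_sigma_subadditive _ _)); first exact: gauge_ge0.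
apply: lee_nneseries => [k _ _|k _]; first by rewrite mu_ext_ge0//; exact: gauge_ge0.
by rewrite -hausdorff_premeasureE hausdorff_premeasure_le.
Qed.

(** No set of diameter at most [delta] meets both [A] and [B], so a cover of the union splits into a
    cover of each without increasing the total cost. *)
Lemma hausdorff_premeasure_separated A B (delta : R) : (0 < delta)%R ->
    (forall x y, A x -> B y -> (delta < euclidean_dist x y)%R) ->
  Hpre delta A + Hpre delta B <= Hpre delta (A `|` B).
Proof.
move=> delta0 AB; apply: le_ereal_inf_tmp => _ [U [ABU Udelta] <-].
(* Members that miss [C] are replaced by the empty set, which costs 0, so that the indexing is
   kept. *)
pose V C k := if `[< U k `&` C !=set0 >] then U k else set0.
have Vcover C : C `<=` A `|` B -> C `<=` \bigcup_k V C k.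
  move=> CAB x Cx; have [k _ Ukx] := ABU _ (CAB _ Cx); exists k => //.
  by rewrite /V asboolT//; exists x.
have preV C : C `<=` A `|` B ->
    Hpre delta C <= \sum_(0 <= k <oo) gauge delta (V C k).
  move=> CAB; rewrite hausdorff_premeasureE; apply: ereal_inf_lbound.
  exists (V C) => //; split; last exact: Vcover.
  by move=> k; exact: sub_sigma_algebra.
apply: (le_trans (leeD (preV A _) (preV B _))); [by left|by right|].
rewrite -nneseriesD//; [|by move=> *; exact: gauge_ge0..].
apply: lee_nneseries => [k _ _|k _].
  by rewrite adde_ge0 ?gauge_ge0.
have -> : (unit_ball_volume d)%:E * (diam (U k) / 2%:E) `^ d =
  gauge delta (U k) by rewrite /gauge Udelta.
rewrite /V; case: asboolP => UA; case: asboolP => UB;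
  rewrite ?gauge0 ?add0e ?adde0 ?gauge_ge0//.
case: UA UB => x [Ux Ax] [y [Uy By]].
have := le_trans (dist_le_diam Ux Uy) (Udelta k).
by rewrite lee_fin leNgt AB.
Qed.

Lemma hausdorff_measure_separated A B (e : R) : (0 < e)%R ->
    (forall x y, A x -> B y -> (e <= euclidean_dist x y)%R) ->
  H A + H B <= H (A `|` B).
Proof.
move=> e0 AB.
(* Independent scales [r] and [s] let the two suprema be taken one after the other; [e / 2] gives
   the strict separation that the premeasure estimate asks for. *)
have key (r s : R) : (0 < r)%R -> (0 < s)%R -> Hpre r A + Hpre s B <= H (A `|` B).
  move=> r0 s0; pose t := Num.min (e / 2)%R (Num.min r s).
  have t0 : (0 < t)%R by rewrite !lt_min r0 s0 divr_gt0.
  have [tr ts te] : [/\ t <= r, t <= s & t < e]%R.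
    split; rewrite ?ge_min ?lexx ?orbT// gt_min; apply/orP; left; lra.
  apply: le_trans (hausdorff_premeasure_le (A `|` B) t0).
  apply: le_trans (hausdorff_premeasure_separated t0 _).
    by apply: leeD; exact: hausdorff_premeasure_anti.
  by move=> x y Ax By; rewrite (lt_le_trans te)// AB.
have [->|Hfin] := eqVneq (H (A `|` B)) +oo; first by rewrite leey.
have fin C : C `<=` A `|` B -> H C \is a fin_num.
  move=> CAB; rewrite ge0_fin_numE ?hausdorff_measure_ge0//.
  by rewrite (le_lt_trans (le_hausdorff_measure CAB))// ltey.
have prefin C r : C `<=` A `|` B -> (0 < r)%R -> Hpre r C \is a fin_num.
  move=> CAB r0; rewrite ge0_fin_numE ?hausdorff_premeasure_ge0//.
  apply: (le_lt_trans (hausdorff_premeasure_le _ r0)).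
  by rewrite -ge0_fin_numE ?hausdorff_measure_ge0// fin.
rewrite -leeBrDr; last by apply: fin; right.
apply: ge_ereal_sup => _ [r r0 <-]; rewrite leeBrDr; last by apply: fin; right.
rewrite -leeBrDl; last by apply: prefin => //; left.
apply: ge_ereal_sup => _ [s s0 <-]; rewrite leeBrDl ?key//.
by apply: prefin => //; left.
Qed.

End hausdorff.

(* Makes the library infer the join of its pointed and pseudometric structures. *)
HB.instance Definition _ (R : realType) (n : nat) := PseudoMetric.on 'rV[R]_n.

Lemma continuous_euclidean_dist (R : realType) (n : nat) (x : 'rV[R]_n) :
  continuous (euclidean_dist x).
Proof.
move=> y; apply: continuous_comp; last exact: sqrt_continuous.
move: y; apply: continuous_big => [|i _ y]; first exact: add_continuous.
have xz : {for y, continuous (fun z : 'rV[R]_n => x ord0 i - z ord0 i)%R}.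
  exact: cvgB (@cvg_cst _ (x ord0 i) _ _ _) (@coord_continuous _ _ _ ord0 i y).
exact: (cvgM xz xz).
Qed.

Lemma open_euclidean_ball (R : realType) (n : nat) (x : 'rV[R]_n) (r : R) :
  open (euclidean_ball x r).
Proof.
rewrite (_ : euclidean_ball x r = euclidean_dist x @^-1` [set s | (s < r)%R])//.
by apply: open_comp => // y _; exact: continuous_euclidean_dist.
Qed.

Lemma euclidean_dist_xx (R : realType) (n : nat) (x : 'rV[R]_n) :
  euclidean_dist x x = 0%R.
Proof. by rewrite /euclidean_dist big1 ?sqrtr0// => i _; rewrite subrr expr0n. Qed.

(** * Restriction of Hausdorff measure to a compact regular set *)

Section hausdorff_restr.
Context {R : realType} {n : nat} (d : R) (E : set 'rV[R]_n).
Hypothesis d_gt0 : (0 < d)%R.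
Local Notation H := (hausdorff_measure d).

Lemma hausdorff_outer_measure :
  exists mu : {outer_measure set 'rV[R]_n -> \bar R}, (mu : set _ -> _) = H.
Proof.
pose H_outer := isOuterMeasure.Build R 'rV[R]_n H (hausdorff_measure0 d_gt0)
  (hausdorff_measure_ge0 d) (@le_hausdorff_measure _ _ d)
  (@hausdorff_measure_sigma_subadditive _ _ d).
by exists (HB.pack_for (OuterMeasure.type R 'rV[R]_n) H H_outer).
Qed.

Lemma hausdorff_restr_outer_measure :
  exists mu : {outer_measure set 'rV[R]_n -> \bar R},
    (mu : set _ -> _) = hausdorff_restr d E.
Proof.
have r0 : hausdorff_restr d E set0 = 0.
  by rewrite /hausdorff_restr set0I hausdorff_measure0.
have r_ge0 A : 0 <= hausdorff_restr d E A by exact: hausdorff_measure_ge0.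
have r_le : {homo hausdorff_restr d E : A B / A `<=` B >-> A <= B}.
  by move=> A B AB; apply: le_hausdorff_measure; exact: setSI.
have r_sub : sigma_subadditive (hausdorff_restr d E).
  move=> F; rewrite /hausdorff_restr setI_bigcupl.
  exact: hausdorff_measure_sigma_subadditive.
pose r_outer := isOuterMeasure.Build R 'rV[R]_n (hausdorff_restr d E)
  r0 r_ge0 r_le r_sub.
by exists (HB.pack_for (OuterMeasure.type R 'rV[R]_n) (hausdorff_restr d E) r_outer).
Qed.

Lemma hausdorff_restr_separated : separated_additive (hausdorff_restr d E).
Proof.
move=> A B e e0 AB; rewrite /hausdorff_restr setIUl.
apply: (hausdorff_measure_separated d_gt0 e0) => x y [Ax _] [By _].
by rewrite leNgt; apply/negP => /ball_euclidean; exact: AB.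
Qed.

Lemma hausdorff_restr_measure : H E < +oo ->
  exists mu : {finite_measure set (borel_space R n) -> \bar R},
    (mu : set 'rV[R]_n -> \bar R) = hausdorff_restr d E.
Proof.
move=> HE; have [nu nuE] := hausdorff_restr_outer_measure.
have := @separated_borel_measure R 'rV[R]_n nu.
rewrite -nuE; apply; rewrite nuE.
  exact: hausdorff_restr_separated.
by rewrite /hausdorff_restr setTI.
Qed.

(** A set of diameter 0 covers itself at every scale at cost 0. The radius obtained is one at which
    Ahlfors regularity can be applied. *)
Lemma hausdorff_measure_gt0_diam : 0 < H E -> exists2 r : R, (0 < r)%R & r%:E <= diam E.
Proof.
move=> HE; have : 0 < diam E.
  rewrite lt_neqAle diam_ge0 andbT; apply/eqP => diamE.
  move: HE; apply/negP; rewrite -leNgt; apply: ge_ereal_sup => _ [delta delta0 <-].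
  apply: ereal_inf_lbound; exists (fun=> E).
    by split=> [x Ex|_]; [exists 0%N|rewrite -diamE lee_fin ltW].
  by rewrite -diamE mul0e poweR0r ?gt_eqF// mule0 eseries0.
case: (diam E) => [r|_|//]; first by exists r.
by exists 1%R; rewrite ?leey.
Qed.

(** Finitely many balls of one admissible radius, centered in [E], cover [E], and regularity bounds
    the mass of each. *)
Lemma compact_hausdorff_measure_lty : compact E -> upper_ahlfors_regular d E ->
  0 < H E -> H E < +oo.
Proof.
move=> cptE [C C0 regE] /hausdorff_measure_gt0_diam[r r0 rE].
have [nu nuE] := hausdorff_outer_measure.
move: cptE; rewrite compact_cover => /(_ _ E (fun x => euclidean_ball x r)).
case=> [x _|x Ex|D DE Ecover]; first exact: open_euclidean_ball.
  by exists x => //; rewrite /euclidean_ball/= euclidean_dist_xx.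
have fin (s : seq 'rV[R]_n) : {subset s <= E} ->
    nu (E `&` \bigcup_(x in [set` s]) euclidean_ball x r) < +oo.
  elim: s => [|x s IH] sE; first by rewrite set_nil bigcup_set0 setI0 outer_measure0.
  rewrite bigcup_seq big_cons -bigcup_seq setIUr.
  apply: (le_lt_trans (outer_measureU2 _ _ _)).
  rewrite lte_add_pinfty//; last by apply: IH => y ys; apply: sE; rewrite inE ys orbT.
  rewrite nuE setIC; apply: le_lt_trans (regE x r _ r0 rE) _; last by rewrite ltry.
  by apply/set_mem/sE; rewrite inE eqxx.
rewrite -nuE; apply: le_lt_trans (fin (finmap.enum_fset D) _).
  by apply: le_outer_measure => x Ex; split=> //; exact: Ecover.
exact: DE.
Qed.

(** The density integral uses radii up to 1, which may exceed the diameter. Beyond an admissible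
    radius [s] the total mass is a bound, and dividing it by [s] to the power [d] gives the second
    candidate for the constant. *)
Lemma hausdorff_restr_ball_le : compact E -> upper_ahlfors_regular d E ->
  0 < H E -> exists2 C : R, (0 <= C)%R & forall x r, E x -> (0 < r)%R ->
    hausdorff_restr d E (euclidean_ball x r) <= (C * r `^ d)%:E.
Proof.
move=> cptE regE HE; have HEfin := compact_hausdorff_measure_lty cptE regE HE.
have [s s0 sE] := hausdorff_measure_gt0_diam HE.
have [C C0 {}regE] := regE.
exists (Num.max C (fine (H E) / s `^ d)%R) => [|x r Ex r0].
  by rewrite le_max (ltW C0).
have [rs|sr] := leP r s.
  apply: (le_trans (regE x r Ex r0 (le_trans _ sE))); first by rewrite lee_fin.
  by rewrite lee_fin ler_wpM2r ?powR_ge0// le_max lexx.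
apply: (@le_trans _ _ (H E)).
  by apply: le_hausdorff_measure => y [].
rewrite -(@fineK _ (H E)) ?ge0_fin_numE ?hausdorff_measure_ge0// lee_fin.
apply: (@le_trans _ _ (fine (H E) / s `^ d * r `^ d)%R); last first.
  by rewrite ler_wpM2r ?powR_ge0// le_max lexx orbT.
rewrite -mulrA ler_peMr ?fine_ge0 ?hausdorff_measure_ge0//.
rewrite mulrC ler_pdivlMr ?powR_gt0// mul1r.
by rewrite ge0_ler_powR ?nnegrE ?ltW.
Qed.

End hausdorff_restr.

(** * Riesz potentials and energies *)

Section powers.
Context {R : realType}.
Local Notation mu := (@lebesgue_measure R).

Lemma measurable_powR_EFin (q : R) (D : set R) :
  measurable_fun D (fun r : R => (r `^ q)%:E).
Proof.
by apply/measurable_EFinP; apply: measurable_funTS; exact: measurable_powR.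
Qed.

(** Negative [q] is allowed: the kernel estimate takes [q = - p], the domination estimate a positive
    [q]. *)
Lemma integral_powR (q s : R) : q != 0%R -> (0 < s < 1)%R ->
  \int[mu]_(r in `[s, 1%R]) (r `^ (q - 1))%:E = ((1 - s `^ q) / q)%:E.
Proof.
move=> q0 /andP[s0 s1].
have dF (x : R) : (0 < x)%R -> is_derive x 1%R (fun r => r `^ q / q)%R (x `^ (q - 1))%R.
  move=> x0.
  have h := is_derive1_powR q x0.
  have -> : (x `^ (q - 1) = q^-1 *: (q * x `^ (q - 1)))%R.
    by rewrite scalerA mulVf// scale1r.
  rewrite (_ : (fun r => r `^ q / q)%R = (q^-1 \*: (fun r : R => r `^ q : R^o))%R).
    exact: is_deriveZ.
  by apply/funext => r; rewrite /= [RHS]mulrC.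
have cF (x : R) : (0 < x)%R -> {for x, continuous (fun r => r `^ q / q)%R}.
  by move=> /dF [dx _]; apply: differentiable_continuous; apply/derivable1_diffP.
rewrite (@continuous_FTC2 _ _ (fun r => r `^ q / q)%R _ _ s1).
- by rewrite powR1 -EFinD mulrBl.
- apply: continuous_in_subspaceT => x /[!inE]/= /[!in_itv]/= /andP[sx _].
  have [dx _] := is_derive1_powR (q - 1) (lt_le_trans s0 sx).
  by apply: differentiable_continuous; apply/derivable1_diffP.
- split.
  + by move=> x /[!in_itv]/= /andP[sx _]; have [] := dF x (lt_trans s0 sx).
  + exact/cvg_at_right_filter/cF.
  + exact/cvg_at_left_filter/cF.
- move=> x /[!in_itv]/= /andP[sx _]; rewrite derive1E.
  exact: @derive_val _ _ _ _ _ _ _ (dF x (lt_trans s0 sx)).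
Qed.

Lemma integral_powR01_le (q : R) : (0 < q)%R ->
  \int[mu]_(r in `]0%R, 1%R[) (r `^ (q - 1))%:E <= (q^-1)%:E.
Proof.
move=> q0.
(* Exhaustion by intervals away from 0, where the primitive is differentiable; [k.+2] keeps the left
   end below 1. *)
pose F k : set R := `[(k.+2%:R^-1)%R, 1%R[%classic.
have -> : `]0%R, 1%R[%classic = \bigcup_k F k.
  apply/seteqP; split => x /=; rewrite !in_itv/=.
    move=> /andP[x0 x1]; exists (Num.truncn x^-1) => //; rewrite /F/= in_itv/= x1 andbT.
    rewrite invf_ple ?posrE//; apply/ltW/(lt_le_trans (truncnS_gt _)).
    by rewrite ler_nat.
  move=> [k _]; rewrite /F/= in_itv/= => /andP[kx ->]; rewrite andbT.
  by rewrite (lt_le_trans _ kx).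
have cvgF : \int[mu]_(x in F i) (x `^ (q - 1))%:E @[i --> \oo] -->
    \int[mu]_(x in \bigcup_k F k) (x `^ (q - 1))%:E.
  apply: ge0_nondecreasing_set_cvg_integral.
  - move=> i j ij; apply/subsetPset => x; rewrite /F/= !in_itv/= => /andP[ix ->].
    by rewrite andbT (le_trans _ ix)// lef_pV2 ?posrE// ler_nat.
  - by move=> k; exact: measurable_itv.
  - by move=> k; exact: measurable_powR_EFin.
  - by move=> k x _; rewrite lee_fin powR_ge0.
apply: (cvge_le _ cvgF).
apply: nearW => k.
apply: (@le_trans _ _ (\int[mu]_(r in `[(k.+2%:R^-1 : R)%R, 1%R]) (r `^ (q - 1))%:E)).
  apply: ge0_subset_integral => //; first exact: measurable_itv.
      exact: measurable_powR_EFin.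
    by move=> x _; rewrite lee_fin powR_ge0.
  by move=> x; rewrite /F/= !in_itv/= => /andP[-> /ltW].
rewrite integral_powR ?gt_eqF//; last first.
  by rewrite invr_gt0 ltr0n invf_lt1// ltr1n.
by rewrite lee_fin ler_pdivrMr// mulVf ?gt_eqF// gerBl powR_ge0.
Qed.

End powers.

Section riesz_potential.
Context {R : realType} {n : nat}.
Local Notation X := (borel_space R n).
Local Notation leb := (@lebesgue_measure R).
Local Notation dist := (@euclidean_dist R n).
Variable nu : {finite_measure set X -> \bar R}.

Lemma measurable_coord (i : 'I_n) :
  measurable_fun setT (fun x : X => (x : 'rV[R]_n) ord0 i).
Proof.
apply: (measurability (@RGenOpens.G R)); first exact: RGenOpens.measurableE.
move=> _ [_ [a [b ->]] <-]; rewrite setTI; apply: sub_sigma_algebra.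
by apply: open_comp => [x _|]; [exact: coord_continuous|exact: interval_open].
Qed.

(** Proved coordinate by coordinate, because Tonelli's theorem needs measurability for the product
    of the two Borel sigma-algebras, not for the Borel sets of the product. *)
Lemma measurable_euclidean_dist :
  measurable_fun setT (fun z : X * X => dist z.1 z.2).
Proof.
apply: measurableT_comp.
  by apply: continuous_measurable_fun; exact: sqrt_continuous.
apply: measurable_sum => i; apply: measurable_funX; apply: measurable_funB.
  by apply: (measurableT_comp (measurable_coord i)); exact: measurable_fst.
by apply: (measurableT_comp (measurable_coord i)); exact: measurable_snd.
Qed.

Lemma measurable_lt_dist :
  measurable [set w : (X * measurableTypeR R) * X | (dist w.1.1 w.2 < w.1.2)%R].
Proof.
have m : measurable_fun setT
    (fun w : (X * measurableTypeR R) * X => (dist w.1.1 w.2 < w.1.2)%R).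
  apply: measurable_fun_ltr.
    apply: (measurableT_comp measurable_euclidean_dist (g := fun w => (w.1.1, w.2))).
    apply: measurable_fun_pair; last exact: measurable_snd.
    by apply: measurableT_comp; [exact: measurable_fst|exact: measurable_fst].
  by apply: (measurableT_comp measurable_snd); exact: measurable_fst.
by have := m measurableT [set true] I; rewrite setTI.
Qed.

Lemma measurable_ball_mass : measurable_fun setT
  (fun z : X * measurableTypeR R => nu (euclidean_ball (z.1 : 'rV[R]_n) z.2)).
Proof.
have := measurable_fun_xsection nu measurable_lt_dist.
apply: eq_measurable_fun => z _ /=; congr (nu _).
by apply/seteqP; split=> y; rewrite /xsection/= inE.
Qed.

Definition ball_mass_integral (p : R) (x : 'rV[R]_n) : \bar R :=
  \int[leb]_(r in `]0%R, 1%R[) (nu (euclidean_ball x r) * (r `^ (- p - 1))%:E).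

Lemma ball_mass_integral_ge0 p x : 0 <= ball_mass_integral p x.
Proof.
by apply: integral_ge0 => r _; rewrite mule_ge0// lee_fin powR_ge0.
Qed.

Lemma measurable_ball_mass_integral p :
  measurable_fun setT (ball_mass_integral p : X -> \bar R).
Proof.
(* The domain of integration becomes an indicator factor, so that Tonelli's theorem applies on the
   whole product. *)
pose f (z : X * measurableTypeR R) : \bar R :=
  nu (euclidean_ball (z.1 : 'rV[R]_n) z.2) * (z.2 `^ (- p - 1))%:E *
  (\1_(`]0%R, 1%R[%classic : set R) z.2)%:E.
have msnd : measurable_fun setT (fun z : X * measurableTypeR R => z.2 : R).
  exact: measurable_snd.
have mf : measurable_fun setT f.
  apply: emeasurable_funM; first apply: emeasurable_funM.
  - exact: measurable_ball_mass.
  - apply/measurable_EFinP.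
    exact: (measurableT_comp (measurable_powR (- p - 1)) msnd).
  - apply/measurable_EFinP.
    have m01 : measurable_fun setT (\1_(`]0%R, 1%R[%classic : set R) : R -> R).
      by apply: measurable_indic; exact: measurable_itv.
    exact: (measurableT_comp m01 msnd).
have f0 z : 0 <= f z by rewrite !mule_ge0// lee_fin ?powR_ge0.
have := measurable_fun_fubini_tonelli_F (m2 := leb) f mf f0.
apply: eq_measurable_fun => x _.
rewrite /ball_mass_integral integral_mkcond; apply: eq_integral => r _.
by rewrite epatch_indic.
Qed.

Lemma riesz_kernelE (p : R) (x y : 'rV[R]_n) : (0 < p)%R ->
  riesz_kernel p x y = if dist x y == 0%R then +oo else (dist x y `^ (- p))%:E.
Proof.
move=> p0; rewrite /riesz_kernel inver; case: ifPn => [_|d0].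
  by rewrite poweRyr// gt_eqF.
by rewrite poweR_EFin -powR_inv1 ?euclidean_dist_ge0// -powRrM mulN1r.
Qed.

Lemma measurable_riesz_kernel (p : R) : (0 < p)%R ->
  measurable_fun setT (fun z : X * X => riesz_kernel p (z.1 : 'rV[R]_n) z.2).
Proof.
move=> p0; under eq_fun do rewrite riesz_kernelE//.
apply: measurable_fun_ifT.
- by apply: measurable_fun_eqr; [exact: measurable_euclidean_dist|exact: measurable_cst].
- exact: measurable_cst.
- apply/measurable_EFinP.
  exact: (measurableT_comp (measurable_powR (- p)) measurable_euclidean_dist).
Qed.

Lemma riesz_kernel_ge0 (p : R) (x y : 'rV[R]_n) : 0 <= riesz_kernel p x y.
Proof. exact: poweR_ge0. Qed.

(** At distance [t] strictly between 0 and 1 the power rule evaluates the integral; for [t >= 1] the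
    kernel is at most 1; at [t = 0] the integral diverges, matching the infinite kernel. *)
Lemma riesz_kernel_le (p : R) (x y : 'rV[R]_n) : (0 < p)%R ->
  riesz_kernel p x y <= p%:E * (\int[leb]_(r in `]0%R, 1%R[)
    ((\1_(euclidean_ball x r) y)%:E * (r `^ (- p - 1))%:E)) + 1.
Proof.
move=> p0; set J := integral _ _ _; set t := dist x y.
have t0 : (0 <= t)%R by exact: euclidean_dist_ge0.
have indE r : (\1_(euclidean_ball x r) y = (t < r)%R%:R :> R)%R.
  by rewrite indicE; congr (nat_of_bool _)%:R; apply/idP/idP; rewrite inE.
have f0 r : 0 <= (\1_(euclidean_ball x r) y)%:E * (r `^ (- p - 1))%:E :> \bar R.
  by rewrite mule_ge0// lee_fin ?powR_ge0.
have J0 : 0 <= J by apply: integral_ge0 => r _; exact: f0.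
have mf D : measurable_fun D
    (fun r : R => (\1_(euclidean_ball x r) y)%:E * (r `^ (- p - 1))%:E).
  apply: emeasurable_funM; last exact: measurable_powR_EFin.
  apply: measurable_funTS; apply/measurable_EFinP.
  under eq_fun do rewrite indE.
  apply: (measurableT_comp (f := fun b : bool => b%:R : R)) => //.
  by apply: measurable_fun_ltr; [exact: measurable_cst|exact: measurable_id].
(* The indicator is 1 on []s, 1[] as soon as [t <= s]. Keeping [s] apart from [t] also serves the
   case [t = 0], where [s] is taken arbitrarily small. *)
have key (s : R) : (0 < s < 1)%R -> (t <= s)%R -> (s `^ (- p) - 1)%:E <= p%:E * J.
  move=> s01 ts; have /andP[s0 s1] := s01.
  have := integral_powR (q := (- p)%R) _ s01.
  rewrite oppr_eq0 gt_eqF// => /(_ erefl) intE.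
  have -> : (s `^ (- p) - 1)%:E = p%:E * ((1 - s `^ (- p)) / (- p))%:E.
    rewrite -EFinM; congr EFin; field; by rewrite gt_eqF.
  rewrite -intE; apply: lee_wpmul2l; first by rewrite lee_fin ltW.
  rewrite -integral_itv_obnd_cbnd; last exact: measurable_powR_EFin.
  rewrite -integral_itv_bndo_bndc; last exact: measurable_powR_EFin.
  apply: (@le_trans _ _ (\int[leb]_(r in `]s, 1%R[)
     ((\1_(euclidean_ball x r) y)%:E * (r `^ (- p - 1))%:E))).
    rewrite le_eqVlt; apply/orP; left; apply/eqP/eq_integral => r.
    rewrite inE/= in_itv/= => /andP[sr _].
    by rewrite indE (le_lt_trans ts sr) mul1e.
  apply: ge0_subset_integral => //; first exact: mf.
  by move=> r /=; rewrite !in_itv/= => /andP[sr ->]; rewrite andbT (lt_trans s0).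
rewrite riesz_kernelE// -/t; case: ifPn => [/eqP t00|tn0].
  suff -> : p%:E * J = +oo by rewrite addye.
  (* This [s] solves [s ^ (- p) - 1 = A], so [key] puts any [A] below the integral. *)
  apply/eqyP => A A0; pose s : R := ((A + 1) `^ (- p^-1))%R.
  have A1 : (1 < A + 1)%R by rewrite ltrDr.
  have sp : (s `^ (- p) = A + 1)%R.
    by rewrite /s -powRrM mulrNN mulVf ?gt_eqF// powRr1// ltW// (lt_trans ltr01).
  have s0 : (0 < s)%R by rewrite powR_gt0// (lt_trans ltr01).
  have s1 : (s < 1)%R.
    rewrite ltNge; apply/negP => s1.
    have : (s `^ (- p) <= s `^ 0)%R by rewrite ler_powR// oppr_le0 ltW.
    by rewrite sp powRr0 leNgt A1.
  have := key s; rewrite s0 s1 t00 => /(_ erefl (ltW s0)).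
  by rewrite sp addrK.
have {}tgt0 : (0 < t)%R by rewrite lt_neqAle eq_sym tn0.
have [t1|t1] := ltP t 1%R.
  rewrite -leeBlDr//; apply: key => //; exact/andP.
apply: (@le_trans _ _ 1).
  by rewrite lee_fin -(powRr0 t) ler_powR// oppr_le0 ltW.
by rewrite leeDr// mule_ge0// lee_fin ltW.
Qed.

End riesz_potential.

Section riesz_energy_bound.
Context {R : realType} {n : nat}.
Local Notation X := (borel_space R n).
Local Notation leb := (@lebesgue_measure R).
Variable nu : {finite_measure set X -> \bar R}.

Lemma measurable_euclidean_ball (x : 'rV[R]_n) (r : R) :
  measurable (euclidean_ball x r : set X).
Proof. by apply: sub_sigma_algebra; exact: open_euclidean_ball. Qed.

Lemma riesz_potential_le (E : set X) (p : R) (x : 'rV[R]_n) :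
  measurable E -> (0 < p)%R ->
  \int[nu]_(y in E) riesz_kernel p x y <= p%:E * ball_mass_integral nu p x + nu setT.
Proof.
move=> mE p0.
pose f (z : X * measurableTypeR R) : \bar R :=
  (\1_(euclidean_ball x z.2) (z.1 : 'rV[R]_n))%:E * (z.2 `^ (- p - 1))%:E *
  (\1_(`]0%R, 1%R[%classic : set R) z.2)%:E.
have msnd : measurable_fun setT (fun z : X * measurableTypeR R => z.2 : R).
  exact: measurable_snd.
have m01 : measurable_fun setT (\1_(`]0%R, 1%R[%classic : set R) : R -> R).
  by apply: measurable_indic; exact: measurable_itv.
have mkern : measurable_fun setT (fun y : X => riesz_kernel p x y).
  exact: (measurable_fun_pair2 (x : X) (measurable_riesz_kernel p0)).
have mball :
    measurable [set z : X * measurableTypeR R | (euclidean_dist x z.1 < z.2)%R].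
  have m : measurable_fun setT
      (fun z : X * measurableTypeR R => (euclidean_dist x z.1 < z.2)%R).
    apply: measurable_fun_ltr; last exact: msnd.
    apply: (measurableT_comp measurable_euclidean_dist 
      (g := fun z : X * measurableTypeR R => ((x : X), z.1))).
    by apply: measurable_fun_pair; [exact: measurable_cst|exact: measurable_fst].
  by have := m measurableT [set true] I; rewrite setTI.
have mf : measurable_fun setT f.
  apply: emeasurable_funM; first apply: emeasurable_funM.
  - apply/measurable_EFinP; have := @measurable_indic _ _ R setT _ mball.
    apply: eq_measurable_fun => z _.
    by rewrite !indicE; congr (nat_of_bool _)%:R; apply/idP/idP; rewrite !inE.
  - apply/measurable_EFinP.
    exact: (measurableT_comp (measurable_powR (- p - 1)) msnd).
  - by apply/measurable_EFinP; exact: (measurableT_comp m01 msnd).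
have f0 z : 0 <= f z by rewrite !mule_ge0// lee_fin ?powR_ge0.
pose F (y : X) := \int[leb]_r f (y, r).
have mF : measurable_fun setT F := measurable_fun_fubini_tonelli_F f mf f0.
have F0 y : 0 <= F y by apply: integral_ge0 => r _; exact: f0.
have kern_le y : riesz_kernel p x y <= p%:E * F y + 1.
  apply: (le_trans (riesz_kernel_le x y p0)).
  rewrite leeD2r// lee_wpmul2l ?lee_fin ?(ltW p0)//.
  rewrite integral_mkcond le_eqVlt; apply/orP; left; apply/eqP.
  by apply: eq_integral => r _; rewrite epatch_indic.
have mpF : measurable_fun setT (fun y => p%:E * F y) by exact: measurable_funeM.
have p_ge0 : 0 <= p%:E by rewrite lee_fin ltW.
have pF0 y : 0 <= p%:E * F y by rewrite mule_ge0.
apply: (@le_trans _ _ (\int[nu]_(y in E) (p%:E * F y + 1))).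
  apply: ge0_le_integral => //.
  - by move=> y _; exact: riesz_kernel_ge0.
  - by apply: measurable_funTS; exact: mkern.
  - by apply: measurable_funTS; apply: emeasurable_funD => //; exact: measurable_cst.
(* Enlarging the domain to the whole space makes the full mass of the ball appear after Tonelli. *)
apply: (@le_trans _ _ (\int[nu]_y (p%:E * F y + 1))).
  apply: ge0_subset_integral => //.
  - by apply: emeasurable_funD => //; exact: measurable_cst.
  - by move=> y _; rewrite adde_ge0.
rewrite ge0_integralD// integral_cst// mul1e ge0_integralZl//.
rewrite leeD2r// lee_wpmul2l// /F (fubini_tonelli f mf f0).
rewrite /ball_mass_integral [leRHS]integral_mkcond.
rewrite le_eqVlt; apply/orP; left; apply/eqP; apply: eq_integral => r _.
rewrite epatch_indic /f/=.
have -> : nu (euclidean_ball x r) = \int[nu]_y (\1_(euclidean_ball x r) y)%:E.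
  by rewrite integral_indic ?setIT//; exact: measurable_euclidean_ball.
rewrite -[in RHS]muleA -ge0_integralZr//; last 2 first.
- by apply/measurable_EFinP; apply: measurable_indic; exact: measurable_euclidean_ball.
- by rewrite mule_ge0// lee_fin powR_ge0.
by apply: eq_integral => y _; rewrite muleA.
Qed.

Lemma measurable_riesz_potential (E : set X) (p : R) : measurable E -> (0 < p)%R ->
  measurable_fun E (fun x : X => \int[nu]_(y in E) riesz_kernel p (x : 'rV[R]_n) y).
Proof.
move=> mE p0.
pose g (z : X * X) : \bar R := riesz_kernel p (z.1 : 'rV[R]_n) z.2 * (\1_E z.2)%:E.
have mg : measurable_fun setT g.
  apply: emeasurable_funM; first exact: measurable_riesz_kernel.
  apply/measurable_EFinP; apply: (measurableT_comp (f := \1_E : X -> R)).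
    exact: measurable_indic.
  exact: measurable_snd.
have g0 z : 0 <= g z by rewrite mule_ge0// ?riesz_kernel_ge0// lee_fin.
have := measurable_fun_fubini_tonelli_F (m2 := nu) g mg g0.
move=> /(measurable_funTS (D := E)); apply: eq_measurable_fun => x _.
by rewrite /fubini_F [RHS]integral_mkcond; apply: eq_integral => y _; rewrite epatch_indic.
Qed.

Lemma riesz_energy_le (E : set X) (p : R) : measurable E -> (0 < p)%R ->
  \int[nu]_(x in E) \int[nu]_(y in E) riesz_kernel p x y <=
    p%:E * \int[nu]_(x in E) ball_mass_integral nu p x + nu setT * nu E.
Proof.
move=> mE p0.
have p_ge0 : 0 <= p%:E by rewrite lee_fin ltW.
have mI : measurable_fun E (ball_mass_integral nu p : X -> \bar R).
  by apply: measurable_funTS; exact: measurable_ball_mass_integral.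
rewrite -ge0_integralZl//; last by move=> x _; exact: ball_mass_integral_ge0.
rewrite -integral_cst// -ge0_integralD//; last 2 first.
- by move=> x _; rewrite mule_ge0// ball_mass_integral_ge0.
- exact: measurable_funeM.
apply: ge0_le_integral => //.
- by move=> x _; apply: integral_ge0 => y _; exact: riesz_kernel_ge0.
- exact: measurable_riesz_potential.
- by apply: emeasurable_funD; [exact: measurable_funeM|exact: measurable_cst].
- by move=> x _; exact: riesz_potential_le.
Qed.

End riesz_energy_bound.

(** * The limit as p tends to d *)

Section second_order_limit.
Context {R : realType} {n : nat}.
Local Notation X := (borel_space R n).
Local Notation leb := (@lebesgue_measure R).
Variables (nu : {finite_measure set X -> \bar R}) (E : set X) (d C : R).
Hypotheses (mE : measurable E) (C0 : (0 <= C)%R)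
  (nuC : forall x r, E x -> (0 < r)%R ->
    nu (euclidean_ball (x : 'rV[R]_n) r) <= (C * r `^ d)%:E).

(** Regularity leaves [C * r ^ (d - p - 1)], whose integral is at most [C / (d - p)]; the factor
    [d - p] cancels, so the dominating constant does not depend on [p]. *)
Lemma ball_mass_integral_le (p : R) (x : X) : E x -> (p < d)%R ->
  (d - p)%:E * ball_mass_integral nu p x <= C%:E.
Proof.
move=> Ex pd; have dp : (0 < d - p)%R by rewrite subr_gt0.
apply: (@le_trans _ _ ((d - p)%:E * (C%:E * ((d - p)^-1)%:E))); last first.
  by rewrite -!EFinM lee_fin mulrCA mulfV ?gt_eqF// mulr1.
apply: lee_wpmul2l; first by rewrite lee_fin ltW.
apply: le_trans (lee_wpmul2l _ (integral_powR01_le dp)); last by rewrite lee_fin.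
rewrite -ge0_integralZl//; last 2 first.
- exact: measurable_powR_EFin.
- by move=> r _; rewrite lee_fin powR_ge0.
apply: ge0_le_integral => //.
- by move=> r _; rewrite mule_ge0// lee_fin powR_ge0.
- apply: emeasurable_funM; last exact: measurable_powR_EFin.
  by apply: measurable_funTS; exact: (measurable_fun_pair2 x (measurable_ball_mass nu)).
- by apply: measurable_funeM; exact: measurable_powR_EFin.
move=> r /=; rewrite in_itv/= => /andP[r0 _].
apply: (@le_trans _ _ ((C * r `^ d)%:E * (r `^ (- p - 1))%:E)).
  by apply: lee_wpmul2r; [rewrite lee_fin powR_ge0|exact: nuC].
rewrite -!EFinM lee_fin -mulrA -powRD; last by rewrite (gt_eqF r0) implybT.
by rewrite addrA.
Qed.

Lemma ball_mass_integral_cvg (sigma : R) :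
  (forall N : set X, measurable N -> N `<=` E `&`
      [set x | ~ ((d - p)%:E * ball_mass_integral nu p x @[p --> d^'-] --> sigma%:E)] ->
    nu N = 0) ->
  (d - p)%:E * \int[nu]_(x in E) ball_mass_integral nu p x @[p --> d^'-] -->
    (sigma * fine (nu E))%:E.
Proof.
move=> nuN; apply/cvge_at_leftP => u [ud ucvg].
pose f k (x : X) := (d - u k)%:E * ball_mass_integral nu (u k) x.
have dp0 k : 0 <= (d - u k)%:E by rewrite lee_fin subr_ge0 ltW.
have mI p : measurable_fun E (ball_mass_integral nu p : X -> \bar R).
  by apply: measurable_funTS; exact: measurable_ball_mass_integral.
have mf k : measurable_fun E (f k) by apply: measurable_funeM.
have f0 k x : 0 <= f k x by rewrite mule_ge0// ball_mass_integral_ge0.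
(* A measurable function that vanishes exactly where [f k x] tends to [sigma]; its nonzero set in
   [E] is the Borel exceptional set for the sequence [u]. *)
pose l x := limn_esup (fun k => `|f k x - sigma%:E|).
have ml : measurable_fun E l.
  apply: measurable_fun_limn_esup => k; apply: measurableT_comp => //.
  by apply: emeasurable_funB => //; exact: measurable_cst.
have f_cvg x : l x = 0 -> f k x @[k --> \oo] --> sigma%:E.
  move=> lx0; apply/sube_cvg0 => //; apply/cvg_abse0P.
  by apply: limn_esup_le_cvg => [|k]; [rewrite -/(l x) lx0|exact: abse_ge0].
pose N := E `&` l @^-1` (~` [set 0]).
have mN : measurable N by apply: ml => //; apply: measurableC.
have N0 : nu N = 0.
  apply: nuN => // x [Ex lx]; split=> // /cvge_at_leftP /(_ u (conj ud ucvg)) h.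
  apply: lx => /=; rewrite /l; apply: (cvg_limn_einf_sup _).2.
  by apply/cvg_abse0P/sube_cvg0.
have f_ae : {ae nu, forall x, E x -> f k x @[k --> \oo] --> cst sigma%:E x}.
  exists N; split=> // x /= /not_implyP[Ex fx]; split => // lx.
  exact/fx/f_cvg.
have f_dom : {ae nu, forall x k, E x -> `|f k x| <= cst C%:E x}.
  by apply: aeW => x k Ex; rewrite gee0_abs//; exact: ball_mass_integral_le.
have C_int : nu.-integrable E (cst C%:E) by exact: finite_measure_integrable_cst.
have [_ _] := dominated_convergence mE mf (measurable_cst _) f_ae C_int f_dom.
rewrite integral_cst// EFinM fineK; last exact: fin_num_measure.
apply: cvg_trans; apply: near_eq_cvg; apply: nearW => k /=.
by rewrite ge0_integralZl// => x _; exact: ball_mass_integral_ge0.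
Qed.

End second_order_limit.

(** Reduces a lower bound that may be infinite, as when the density is 0, to finite positive levels,
    which can be inverted. *)
Lemma lee_pos_dense (R : realType) (x y : \bar R) : 0 < x ->
  (forall a : R, (0 < a)%R -> a%:E < x -> a%:E <= y) -> x <= y.
Proof.
case: x => [r| |]//; rewrite ?lte_fin => r0 h.
  case: y h => [s| |] h; rewrite ?leey//.
    rewrite lee_fin leNgt; apply/negP => sr; pose m := Num.max s 0%R.
    have [sm m0 mr] : [/\ s <= m, 0 <= m & m < r]%R.
      by rewrite /m !le_max gt_max sr r0 !lexx orbT.
    have := h ((m + r) / 2)%R; rewrite lte_fin lee_fin.
    by move=> /(_ ltac:(lra) ltac:(lra)); lra.
  have := h (r / 2)%R; rewrite lte_fin => /(_ ltac:(lra) ltac:(lra)).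
  by rewrite leeNy_eq.
case: y h => [s| |] h //; last by have := h 1%R ltr01 (ltry _).
have s1 : (0 < `|s| + 1)%R by rewrite ltr_wpDl.
have := h _ s1 (ltry _); rewrite lee_fin leNgt.
by rewrite (le_lt_trans (ler_norm s))// ltrDl.
Qed.

(** * Capacity as inverse energy, and the final estimate *)

Section riesz_capacity.
Context {R : realType} {n : nat}.
Local Notation X := (borel_space R n).

Lemma riesz_energy_ge0 (p : R) (E : set 'rV[R]_n) : 0 <= riesz_energy p E.
Proof.
apply: le_ereal_inf_tmp => _ [mu _ <-].
by do 2!apply: integral_ge0 => ? _; exact: riesz_kernel_ge0.
Qed.

Lemma poweR_riesz_capacity (p : R) (E : set 'rV[R]_n) : (0 < p)%R ->
  (riesz_capacity p E) `^ p = (riesz_energy p E)^-1.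
Proof.
move=> p0; rewrite /riesz_capacity -poweRrM mulVf ?gt_eqF//.
by rewrite poweRe1// inve_ge0 riesz_energy_ge0.
Qed.

Lemma riesz_energy_le_normalized (nu : {finite_measure set X -> \bar R})
    (E : set X) (p : R) : measurable E -> (0 < p)%R -> 0 < nu E -> nu setT = nu E ->
  riesz_energy p E <= ((fine (nu E))^-1 ^+ 2)%:E *
    (p%:E * \int[nu]_(x in E) ball_mass_integral nu p x + nu E * nu E).
Proof.
move=> mE p0 nuE0 nuT; have finE := fin_num_measure nu _ mE.
have M0 : (0 < fine (nu E))%R by rewrite fine_gt0// nuE0 ltey_eq finE.
have k0 : (0 <= (fine (nu E))^-1)%R by rewrite invr_ge0 ltW.
pose k : {nonneg R} := NngNum k0.
(* [dirac point] is the fallback for a mass that is 0 or infinite; here the mass is positive and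
   finite, so [mu] is [nu] scaled by its inverse. *)
pose mu : probability X R := mnormalize nu (dirac point).
have muE A : mu A = mscale k nu A.
  rewrite /mu/= /mnormalize/= nuT gt_eqF//= (_ : (nu E == +oo) = false).
    by rewrite /mscale/= muleC.
  by apply/negbTE; rewrite -ltey ltey_eq finE.
have mkern (x : X) : measurable_fun setT (fun z : X => riesz_kernel p (x : 'rV[R]_n) z).
  exact: (measurable_fun_pair2 x (measurable_riesz_kernel p0)).
have intE (f : X -> \bar R) : measurable_fun E f -> (forall x, 0 <= f x) ->
    \int[mu]_(x in E) f x = (k%:num)%:E * \int[nu]_(x in E) f x.
  move=> mf f0; rewrite -ge0_integral_mscale//.
  by apply: eq_measure_integral => A mA _; exact: muE.
have mpot : measurable_fun E (fun x : X => \int[nu]_(y in E) riesz_kernel p (x : 'rV[R]_n) y).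
  exact: measurable_riesz_potential.
apply: (@le_trans _ _ (\int[mu]_(x in E) \int[mu]_(y in E) riesz_kernel p x y)).
  apply: ereal_inf_lbound; exists mu => //.
  rewrite /= muE /mscale/= -[X in _ * X](fineK finE) -EFinM mulVf// gt_eqF//.
have -> : \int[mu]_(x in E) \int[mu]_(y in E) riesz_kernel p x y =
   \int[mu]_(x in E) ((k%:num)%:E * \int[nu]_(y in E) riesz_kernel p x y).
  apply: eq_integral => x _; apply: intE => [|y]; last exact: riesz_kernel_ge0.
  by apply: measurable_funTS; exact: mkern.
have pot0 x : 0 <= \int[nu]_(y in E) riesz_kernel p x y.
  by apply: integral_ge0 => y _; exact: riesz_kernel_ge0.
rewrite intE; last 2 first.
- exact: measurable_funeM.
- by move=> x; rewrite mule_ge0// lee_fin.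
rewrite ge0_integralZl// muleA -EFinM -expr2.
rewrite lee_wpmul2l ?lee_fin ?sqr_ge0//.
by have := riesz_energy_le nu mE p0; rewrite nuT.
Qed.

End riesz_capacity.

Unset Implicit Arguments.

(* [sigma] is the constant value of the second-order density. The inverse of 0
   in [\bar R] is +oo, so the bound is +oo if [sigma] is 0. *)
Theorem corollary1p6 (R : realType) (n : nat) (d : R) (E : set 'rV[R]_n)
    (n_ge1 : (1 <= n)%N) (d_gt0 : (0 < d)%R)
    (cptE : compact E) (regE : upper_ahlfors_regular d E)
    (E_gt0 : 0 < hausdorff_measure d E)
    (sigma : R)
    (densE : hausdorff_measure d
       (E `&` [set x | ~ has_second_order_density d (hausdorff_restr d E)
                           x sigma]) = 0) :
  limf_einf (fun p : R => (riesz_capacity p E) `^ p / (d - p)%:E) d^'-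
    >= hausdorff_measure d E / (d * sigma)%:E.
Proof.
have E_fin := compact_hausdorff_measure_lty d_gt0 cptE regE E_gt0.
have [nu nuE] := hausdorff_restr_measure d_gt0 E_fin.
have mE : measurable (E : set (borel_space R n)).
  rewrite -(setCK E); apply: measurableC; apply: sub_sigma_algebra.
  by apply: closed_openC; apply: compact_closed cptE; exact: norm_hausdorff.
have nuEE : nu E = hausdorff_measure d E.
  by rewrite nuE /hausdorff_restr setIid.
have nuT : nu setT = nu E by rewrite nuEE nuE /hausdorff_restr setTI.
rewrite -nuEE; set M := fine (nu E).
have EM : nu E = M%:E by rewrite fineK// fin_num_measure.
have M0 : (0 < M)%R by rewrite -lte_fin -EM nuEE.
have [C C0 nuC] := hausdorff_restr_ball_le d_gt0 cptE regE E_gt0.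
have cvgG : (d - p)%:E * \int[nu]_(x in E) ball_mass_integral nu p x
    @[p --> d^'-] --> (sigma * M)%:E.
  apply: (ball_mass_integral_cvg mE C0) => [x r Ex r0|N mN NE].
    by rewrite nuE; exact: nuC.
  (* The exceptional set has outer measure 0, and its Borel subset [N] inherits this by
     monotonicity. *)
  apply/eqP; rewrite eq_le measure_ge0 andbT -densE nuE.
  apply: le_hausdorff_measure => x [Nx Ex]; split=> //.
  have [_] := NE _ Nx; apply: contra_not; rewrite /has_second_order_density.
  by rewrite /ball_mass_integral nuE.
have sigma0 : (0 <= sigma)%R.
  rewrite -(pmulr_lge0 _ M0) -lee_fin; apply: (cvge_ge _ cvgG); near=> p.
  rewrite mule_ge0//; last by apply: integral_ge0 => x _; exact: ball_mass_integral_ge0.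
  rewrite lee_fin subr_ge0; near: p; exact: nbhs_left_le.
have /fine_cvgP[finG cvg_fineG] := cvgG.
pose G p := fine ((d - p)%:E * \int[nu]_(x in E) ball_mass_integral nu p x).
(* The real-valued upper bound for [(d - p)] times the energy; its mass term vanishes in the limit,
   leaving [d * sigma / M]. *)
pose W p : R := (M^-1 ^+ 2 * (p * G p + (d - p) * (M * M)))%R.
have cvgW : W p @[p --> d^'-] --> (d * sigma / M)%R.
  have -> : (d * sigma / M = M^-1 ^+ 2 * (d * (sigma * M) + (d - d) * (M * M)))%R.
    by field; rewrite gt_eqF.
  have cvg_id : p @[p --> d^'-] --> d by exact: cvg_at_left_filter.
  apply: cvgMr; apply: cvgD; first exact: cvgM.
  by apply: cvgMl; apply: cvgB => //; exact: cvg_cst.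
have V_le p : (0 < p < d)%R ->
    (d - p)%:E * \int[nu]_(x in E) ball_mass_integral nu p x \is a fin_num ->
  (d - p)%:E * riesz_energy p E <= (W p)%:E.
  move=> /andP[p0 pd] fG; have dp : (0 < d - p)%R by rewrite subr_gt0.
  apply: (@le_trans _ _ ((d - p)%:E * (((fine (nu E))^-1 ^+ 2)%:E *
    (p%:E * \int[nu]_(x in E) ball_mass_integral nu p x + nu E * nu E)))).
    rewrite lee_wpmul2l ?lee_fin ?(ltW dp)//.
    by apply: riesz_energy_le_normalized => //; rewrite EM lte_fin.
  rewrite /W /G; move: fG; rewrite EM -/M.
  have : 0 <= \int[nu]_(x in E) ball_mass_integral nu p x.
    by apply: integral_ge0 => x _; exact: ball_mass_integral_ge0.
  case: integral => [j| |] // _.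
    by move=> _; rewrite -!(EFinM, EFinD) lee_fin /=; lra.
  by rewrite gt0_muley.
apply: lee_pos_dense => [|a a0 aL].
  rewrite EM mule_gt0 ?lte_fin// inver; case: ifPn => // ds0.
  by rewrite lte_fin invr_gt0 lt_neqAle eq_sym ds0 mulr_ge0// ltW.
(* Inverting [a < M / (d * sigma)] moves the comparison to finite reals; if [sigma] is 0, the left
   side is 0 and any positive [a] qualifies. *)
have a_gt : (d * sigma / M < a^-1)%R.
  have [s0|s0] := eqVneq sigma 0%R.
    by rewrite s0 mulr0 mul0r invr_gt0.
  have ds : (0 < d * sigma)%R by rewrite mulr_gt0// lt_neqAle eq_sym s0.
  move: aL; rewrite EM inver gt_eqF// -EFinM lte_fin ltr_pdivlMr// => aL.
  by rewrite ltr_pdivrMr// [ltRHS]mulrC ltr_pdivlMr// mulrC.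
(* The lower limit is a supremum of infima over sets of the filter. The set where [a] bounds the
   quotient is itself such a set near [d], and its infimum is at least [a]. *)
rewrite limf_einfE; apply: le_trans (ereal_sup_ubound _); last first.
  exists [set p | a%:E <= riesz_capacity p E `^ p / (d - p)%:E]; last by [].
  near=> p.
  have p0 : (0 < p)%R by near: p; exact: nbhs_left_gt.
  have pd : (p < d)%R by near: p; exact: nbhs_left_lt.
  have Wp : (W p < a^-1)%R.
    by near: p; apply: cvgr_lt cvgW _ a_gt.
  have fGp : (d - p)%:E * \int[nu]_(x in E) ball_mass_integral nu p x \is a fin_num.
    by near: p.
  have dp : (0 < d - p)%R by rewrite subr_gt0.
  rewrite /= poweR_riesz_capacity// [X in _ * X]inver gt_eqF//.
  have := V_le p; rewrite p0 pd => /(_ erefl fGp).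
  (* Zero energy makes the quotient infinite; infinite energy would contradict the finite bound
     [W p]. *)
  have := riesz_energy_ge0 p E; case: riesz_energy => [v| |] //.
    rewrite lee_fin -EFinM lee_fin => v0 vW.
    rewrite inver; case: ifPn => [_|vn0].
      by rewrite gt0_mulye ?leey// lte_fin invr_gt0.
    have {}v0 : (0 < v)%R by rewrite lt_neqAle eq_sym vn0.
    rewrite -EFinM lee_fin -invfM -[leLHS]invrK lef_pV2 ?posrE ?invr_gt0 ?mulr_gt0//.
    by rewrite mulrC ltW// (le_lt_trans vW).
  by rewrite gt0_muley.
by apply: le_ereal_inf_tmp => _ [p ap <-].
Unshelve. all: by end_near.
Qed.
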